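(* Let $n\ge2$ and $1\le k\le n-1$ be integers. On each non-constant Fourier mode $m\in\{1,\dots,n-1\}$ the quadratic form $Q_{n,k}$ has coefficient \[ \gamma_{m,k}=\frac{|\lambda_{m,k}|^2-k\operatorname{Re}\lambda_{m,k}}{k^3},\qquad \lambda_{m,k}=\sum_{j=1}^k e^{2\pi\mathrm{i} mj/n}. \] Consequently, for every $u\in\mathbb R^n$ with $\sum_{i=1}^n u_i=0$, \[ Q_{n,k}(u)\ \ge\ C_{n,k}^{\rm loc}\sum_{i=1}^n u_i^2,\qquad C_{n,k}^{\rm loc}=\min_{1\le m\le n-1}\gamma_{m,k}, \] and the constant $C_{n,k}^{\rm loc}$ is sharp, i.e. it is the largest real constant for which this inequality holds for all such $u$.
   Context: For $u=(u_1,\dots,u_n)\in\mathbb R^n$ with indices modulo $n$, put $L_i=u_{i+1}+\cdots+u_{i+k}$ and \[ Q_{n,k}(u)=-\frac1{k^2}\sum_{i=1}^n u_iL_i+\frac1{k^3}\sum_{i=1}^n L_i^2 . \] ''$Q_{n,k}$ has coefficient $\gamma$ on the Fourier mode $m$'' means that $Q_{n,k}(u)=\gamma\sum_{i=1}^n u_i^2$ for every $u$ in the real span of the two vectors $(\cos(2\pi mi/n))_{i=1}^n$ and $(\sin(2\pi mi/n))_{i=1}^n$. *)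

(* Defs.v *)
From mathcomp Require Import all_boot all_order all_algebra.
From mathcomp Require Import complex.
From mathcomp Require Import all_classical all_reals all_analysis.

Set Implicit Arguments.
Unset Strict Implicit.
Unset Printing Implicit Defensive.

Import Order.TTheory GRing.Theory Num.Theory.
Local Open Scope ring_scope.
Local Open Scope complex_scope.

(* Indices modulo n are represented by 'I_n = {0, ..., n-1}; the index n of
   the range 1..n is therefore the ordinal 0. *)
Definition cyc_shift (n : nat) (i : 'I_n) (j : nat) : 'I_n :=
  Ordinal (ltn_pmod (i + j) (leq_ltn_trans (leq0n i) (ltn_ord i))).

Definition Lsum (R : realType) (n k : nat) (u : 'rV[R]_n) (i : 'I_n) : R :=
  \sum_(1 <= j < k.+1) u 0 (cyc_shift i j).

Definition Qform (R : realType) (n k : nat) (u : 'rV[R]_n) : R :=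
  - (1 / k%:R ^+ 2) * (\sum_(i < n) u 0 i * Lsum k u i)
  + 1 / k%:R ^+ 3 * (\sum_(i < n) Lsum k u i ^+ 2).

(* Both vectors are n-periodic in i, so their entry at the ordinal 0 is the
   entry at i = n. *)
Definition cos_mode (R : realType) (n m : nat) : 'rV[R]_n :=
  \row_(i < n) cos (2 * pi * m%:R * i%:R / n%:R).

Definition sin_mode (R : realType) (n m : nat) : 'rV[R]_n :=
  \row_(i < n) sin (2 * pi * m%:R * i%:R / n%:R).

Definition has_coefficient_on_mode (R : realType) (n k : nat) (gam : R)
    (m : nat) : Prop :=
  forall u : 'rV[R]_n, u \in <<[:: cos_mode R n m; sin_mode R n m]>>%VS ->
    Qform k u = gam * \sum_(i < n) u 0 i ^+ 2.

Definition cexp (R : realType) (z : R[i]) : R[i] :=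
  (expR (complex.Re z))%:C * (cos (complex.Im z) +i* sin (complex.Im z)).

Definition lambda (R : realType) (n m k : nat) : R[i] :=
  \sum_(1 <= j < k.+1)
    cexp ((2 * pi * m%:R * j%:R / n%:R)%:C * 'i%C).

(* [normc] is the modulus with values in R; the norm of the numeric field
   R[i] takes its values in R[i]. *)
Definition gamma_coef (R : realType) (n m k : nat) : R :=
  (ComplexField.Normc.normc (lambda R n m k) ^+ 2
   - k%:R * complex.Re (lambda R n m k)) / k%:R ^+ 3.

(* For n >= 2 the default value gamma_{1,k} is one of the values over which
   the minimum is taken, so it does not affect the result. *)
Definition Cloc (R : realType) (n k : nat) : R :=
  \big[Num.min/gamma_coef R n 1 k]_(1 <= m < n) gamma_coef R n m k.

(* Main.v *)
Require Import Defs.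
From mathcomp Require Import all_boot all_order all_algebra.
From mathcomp Require Import complex.
From mathcomp Require Import all_classical all_reals all_analysis.
From mathcomp Require Import ring lra zify.

Import Order.TTheory GRing.Theory Num.Theory.
Local Open Scope ring_scope.

(** The cyclic window sum [u |-> L u] is a circulant operator, so the discrete
    Fourier transform diagonalises it, with eigenvalue the conjugate of
    [lambda_p] on mode [p].  Writing [a_p, b_p] for the cosine and sine
    coefficients of [u], Parseval's identity gives
    [n Q(u) = \sum_p gamma_p (a_p^2 + b_p^2)] and
    [n |u|^2 = \sum_p (a_p^2 + b_p^2)].  A vector of mode [m] only has
    coefficients at [p = m] and [p = n - m], where
    [gamma_(n - m) = gamma_m]; a vector of zero sum has none at [p = 0]; and
    the cosine mode [m] shows that no constant above [gamma_m] works. *)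

(** * Angles modulo full turns *)

Definition angle (R : realType) (n d : nat) : R := 2 * pi * d%:R / n%:R.

Lemma angleD (R : realType) (n a b : nat) :
  angle R n (a + b) = angle R n a + angle R n b.
Proof. by rewrite /angle natrD; ring. Qed.

Lemma angle_period (R : realType) (n d : nat) :
  (0 < n)%N -> angle R n (n * d) = (pi *+ 2) *+ d.
Proof.
move=> n0; have nR : n%:R != 0 :> R by rewrite pnatr_eq0 -lt0n.
by rewrite /angle natrM -[RHS]mulr_natr -[pi *+ 2]mulr_natr; field.
Qed.

Lemma cosD_angle (R : realType) (n d : nat) (x : R) :
  (0 < n)%N -> cos (x + angle R n (n * d)) = cos x.
Proof. by move=> n0; rewrite angle_period // (periodicn (@cosD2pi R)). Qed.

Lemma sinD_angle (R : realType) (n d : nat) (x : R) :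
  (0 < n)%N -> sin (x + angle R n (n * d)) = sin x.
Proof. by move=> n0; rewrite angle_period // (periodicn (@sinD2pi R)). Qed.

(** Reducing an index modulo [n] costs whole turns only; this undoes the [%%] in [cyc_shift]. *)
Lemma angle_modn (R : realType) (n p d : nat) :
  angle R n (p * d) = angle R n (p * (d %% n)) + angle R n (n * (p * (d %/ n))).
Proof. by rewrite -angleD; congr angle; rewrite {1}(divn_eq d n); lia. Qed.

(** Stays within naturals: [i + (n - j)] stands for the index difference [i - j], at the price of
    [m] full turns. *)
Lemma angle_sub (R : realType) (n m i j : nat) : (j <= n)%N ->
  angle R n (m * (i + (n - j))) =
  angle R n (m * i) - angle R n (m * j) + angle R n (n * m).
Proof.
move=> jn.
have := angleD R n (m * (i + (n - j))) (m * j).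
have -> : (m * (i + (n - j)) + m * j = m * i + n * m)%N by nia.
by rewrite angleD => E; lra.
Qed.

(** With [r] the residue of [d], the half-angle formula makes 1 minus the cosine equal to twice the
    squared sine of [pi * r / n], an angle strictly between 0 and [pi]. *)
Lemma cos_angle_neq1 (R : realType) (n d : nat) :
  (0 < n)%N -> ~~ (n %| d)%N -> cos (angle R n d) != 1.
Proof.
move=> n0 nd.
have nR : 0 < n%:R :> R by rewrite ltr0n.
rewrite -(mul1n d) angle_modn cosD_angle // mul1n.
have r0 : (0 < d %% n)%N by rewrite lt0n.
have rn : (d %% n < n)%N by rewrite ltn_mod.
set r := (d %% n)%N in r0 rn *.
have -> : angle R n r = (pi * r%:R / n%:R) *+ 2.
  by rewrite -[RHS]mulr_natr /angle; ring.
have s0 : 0 < sin (pi * r%:R / n%:R : R).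
  apply: sin_gt0_pi; rewrite divr_gt0 ?mulr_gt0 ?pi_gt0 ?ltr0n //=.
  by rewrite ltr_pdivrMr // ltr_pM2l ?pi_gt0 // ltr_nat.
rewrite cos_mulr2n cos2sin2; apply/eqP => E.
have : sin (pi * r%:R / n%:R : R) ^+ 2 = 0 by move: E; rewrite mulr2n; lra.
by apply/eqP; rewrite expf_neq0 // gt_eqF.
Qed.

(** * Trigonometric sums over a full period *)

Lemma sum_shift (R : realType) (n : nat) (f : nat -> R) :
  f n = f 0%N -> \sum_(i < n) f i.+1 = \sum_(i < n) f i.
Proof.
move=> fn; apply/eqP; rewrite -subr_eq0 -sumrB.
rewrite -(big_mkord xpredT (fun i => f i.+1 - f i)) telescope_sumr //.
by rewrite fn subrr.
Qed.

(* Shifting the summation index rotates the vector (sum of cosines, sum of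
   sines) by [angle n d], so it vanishes unless the rotation is trivial. *)
Lemma sum_angle (R : realType) (n d : nat) : (0 < n)%N ->
  \sum_(i < n) cos (angle R n (d * i)) = n%:R * (n %| d)%N%:R /\
  \sum_(i < n) sin (angle R n (d * i)) = 0.
Proof.
move=> n0.
have [/dvdnP[q ->]|nd] := boolP (n %| d)%N.
  have E (i : nat) : angle R n (q * n * i) = 0 + angle R n (n * (q * i)).
    by rewrite add0r; congr angle; lia.
  split.
    under eq_bigr do rewrite E cosD_angle // cos0.
    by rewrite sumr_const card_ord mulr1.
  by rewrite big1 // => i _; rewrite E sinD_angle // sin0.
have dn : (d * n = n * d)%N by lia.
pose t := angle R n d.
set S := \sum_(i < n) cos _; set T := \sum_(i < n) sin _.
have ES : S = S * cos t - T * sin t.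
  rewrite {1}/S -(sum_shift _ _ (fun i => cos (angle R n (d * i)))); last first.
    by rewrite dn -[angle _ _ _]add0r cosD_angle // muln0 /angle mulr0 mul0r.
  rewrite /S /T !mulr_suml -sumrB; apply: eq_bigr => i _.
  by rewrite mulnS addnC angleD cosD.
have ET : T = T * cos t + S * sin t.
  rewrite {1}/T -(sum_shift _ _ (fun i => sin (angle R n (d * i)))); last first.
    by rewrite dn -[angle _ _ _]add0r sinD_angle // muln0 /angle mulr0 mul0r.
  rewrite /S /T !mulr_suml -big_split; apply: eq_bigr => i _ /=.
  by rewrite mulnS addnC angleD sinD.
(* The determinant of the identity minus the rotation by [t]; [S0] and [T0] are Cramer's rule for
   the system [ES], [ET]. *)
have c1 : 2 * (1 - cos t) != 0.
  by rewrite mulf_neq0 ?pnatr_eq0 // subr_eq0 eq_sym cos_angle_neq1.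
have cs := cos2sin2 t.
have S0 : 2 * (1 - cos t) * S = 0.
  have -> : 2 * (1 - cos t) * S
    = (1 - cos t) * (S - (S * cos t - T * sin t))
      - sin t * (T - (T * cos t + S * sin t))
      + S * (1 - sin t ^+ 2 - cos t ^+ 2) by ring.
  by rewrite -ES -ET cs !subrr !mulr0 subr0 addr0.
have T0 : 2 * (1 - cos t) * T = 0.
  have -> : 2 * (1 - cos t) * T
    = (1 - cos t) * (T - (T * cos t + S * sin t))
      + sin t * (S - (S * cos t - T * sin t))
      + T * (1 - sin t ^+ 2 - cos t ^+ 2) by ring.
  by rewrite -ES -ET cs !subrr !mulr0 !addr0.
have cancel x : 2 * (1 - cos t) * x = 0 -> x = 0.
  by move/eqP; rewrite mulf_eq0 (negPf c1) => /eqP.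
by rewrite (cancel _ S0) (cancel _ T0) mulr0.
Qed.

(** * Discrete Fourier transform and Parseval's identity *)

Definition dft_cos (R : realType) (n : nat) (u : 'rV[R]_n) (p : nat) : R :=
  \sum_(i < n) u 0 i * cos (angle R n (p * i)).

Definition dft_sin (R : realType) (n : nat) (u : 'rV[R]_n) (p : nat) : R :=
  \sum_(i < n) u 0 i * sin (angle R n (p * i)).

(** Each summand expands into a double sum of cosines of angle differences. Summing over [p] first,
    [sum_angle] keeps only the diagonal [i = j]. *)
Lemma parseval (R : realType) (n : nat) (u v : 'rV[R]_n) :
  \sum_(p < n) (dft_cos R n u p * dft_cos R n v p
                + dft_sin R n u p * dft_sin R n v p)
  = n%:R * \sum_(i < n) u 0 i * v 0 i.
Proof.
have E (p : 'I_n) :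
    dft_cos R n u p * dft_cos R n v p + dft_sin R n u p * dft_sin R n v p
    = \sum_(i < n) \sum_(j < n)
        u 0 i * v 0 j * cos (angle R n ((i + (n - j)) * p)).
  rewrite /dft_cos /dft_sin !mulr_suml -big_split; apply: eq_bigr => i _ /=.
  rewrite !mulr_sumr -big_split; apply: eq_bigr => j _ /=.
  rewrite [in RHS]mulnC angle_sub; last exact: ltnW.
  rewrite cosD_angle; last exact: leq_ltn_trans (ltn_ord j).
  by rewrite cosB; ring.
under eq_bigr do rewrite E.
rewrite exchange_big mulr_sumr; apply: eq_bigr => i _ /=.
have n0 : (0 < n)%N := leq_ltn_trans (leq0n i) (ltn_ord i).
rewrite exchange_big /=.
under eq_bigr do rewrite -mulr_sumr (sum_angle R n _ n0).1.
rewrite (bigD1 i) //= [X in _ + X]big1 => [|j ji].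
  by rewrite subnKC ?dvdnn ?(ltnW (ltn_ord i)) /=; ring.
suff -> : (n %| i + (n - j))%N = false by rewrite !mulr0.
apply/negP => /dvdnP[q]; have := ltn_ord i; have := ltn_ord j.
move: ji; rewrite -val_eqE /= => ji jn iN qE.
(* [i + (n - j)] lies strictly between 0 and [2n], so as a multiple of [n] it is [n], which forces
   [i = j]. *)
have : (q = 1)%N by nia.
by move=> q1; move: qE ji; rewrite q1; lia.
Qed.

(** * The window sum in Fourier coordinates *)

Definition window (R : realType) (n k : nat) (u : 'rV[R]_n) : 'rV[R]_n :=
  \row_i Lsum k u i.

Lemma cyc_shift_inj (n j : nat) : injective (fun i : 'I_n => cyc_shift i j).
Proof.
move=> a b /(congr1 val) /= /eqP; rewrite eqn_modDr => /eqP.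
by rewrite !modn_small // => /val_inj.
Qed.

Definition lambda_re (R : realType) (n p k : nat) : R :=
  \sum_(1 <= j < k.+1) cos (angle R n (p * j)).

Definition lambda_im (R : realType) (n p k : nat) : R :=
  \sum_(1 <= j < k.+1) sin (angle R n (p * j)).

(** Reindexing by [i + j] turns the shift by [j] into a phase. For the complex coefficient
    [dft_cos + i dft_sin] this is the real part of multiplication by the conjugate of [lambda];
    [dft_sin_window] is the imaginary part. *)
Lemma dft_cos_window (R : realType) (n k : nat) (u : 'rV[R]_n) (p : nat) :
  dft_cos R n (window R n k u) p
  = lambda_re R n p k * dft_cos R n u p + lambda_im R n p k * dft_sin R n u p.
Proof.
rewrite /dft_cos; under eq_bigr do rewrite mxE /Lsum mulr_suml.
rewrite exchange_big /= /lambda_re /lambda_im !mulr_suml -big_split /=.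
apply: eq_bigr => j _.
rewrite /dft_cos /dft_sin !mulr_sumr -big_split /=.
rewrite [RHS](reindex_inj (cyc_shift_inj n j)); apply: eq_bigr => i _ /=.
have n0 : (0 < n)%N by exact: leq_ltn_trans (ltn_ord i).
have -> : angle R n (p * i) = angle R n (p * (i + j)) - angle R n (p * j).
  by rewrite mulnDr angleD; ring.
rewrite angle_modn addrAC cosD_angle // cosB; ring.
Qed.

Lemma dft_sin_window (R : realType) (n k : nat) (u : 'rV[R]_n) (p : nat) :
  dft_sin R n (window R n k u) p
  = lambda_re R n p k * dft_sin R n u p - lambda_im R n p k * dft_cos R n u p.
Proof.
rewrite /dft_sin; under eq_bigr do rewrite mxE /Lsum mulr_suml.
rewrite exchange_big /= /lambda_re /lambda_im !mulr_suml -sumrB /=.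
apply: eq_bigr => j _.
rewrite /dft_cos /dft_sin !mulr_sumr -sumrB /=.
rewrite [RHS](reindex_inj (cyc_shift_inj n j)); apply: eq_bigr => i _ /=.
have n0 : (0 < n)%N by exact: leq_ltn_trans (ltn_ord i).
have -> : angle R n (p * i) = angle R n (p * (i + j)) - angle R n (p * j).
  by rewrite mulnDr angleD; ring.
rewrite angle_modn addrAC sinD_angle // sinB; ring.
Qed.

Lemma lambdaE (R : realType) (n p k : nat) :
  lambda R n p k = (lambda_re R n p k +i* lambda_im R n p k)%C.
Proof.
rewrite /lambda /lambda_re /lambda_im; elim/big_ind3: _ => //.
  by move=> x1 x2 x3 y1 y2 y3 -> ->.
move=> j _; rewrite /cexp /angle natrM.
set x := 2 * pi * p%:R * j%:R / n%:R.
have -> : 2 * pi * (p%:R * j%:R) / n%:R = x by rewrite /x; ring.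
by simpc; rewrite /= expR0 !mul1r; simpc.
Qed.

Lemma gamma_coefE (R : realType) (n p k : nat) :
  gamma_coef R n p k
  = (lambda_re R n p k ^+ 2 + lambda_im R n p k ^+ 2 - k%:R * lambda_re R n p k)
    / k%:R ^+ 3.
Proof.
by rewrite /gamma_coef lambdaE /= sqr_sqrtr // addr_ge0 // sqr_ge0.
Qed.

(** * Spectral form of Q *)

Definition dft_energy (R : realType) (n : nat) (u : 'rV[R]_n) (p : nat) : R :=
  dft_cos R n u p ^+ 2 + dft_sin R n u p ^+ 2.

Lemma sum_dft_energy (R : realType) (n : nat) (u : 'rV[R]_n) :
  \sum_(p < n) dft_energy R n u p = n%:R * \sum_(i < n) u 0 i ^+ 2.
Proof. exact: parseval. Qed.

(** Parseval for the pair [u], [window u] brings out the real part of [lambda], and for [window u]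
    with itself its squared modulus. *)
Lemma Qform_spectral (R : realType) (n k : nat) (u : 'rV[R]_n) : (0 < k)%N ->
  n%:R * Qform k u = \sum_(p < n) gamma_coef R n p k * dft_energy R n u p.
Proof.
move=> k0; have kR : k%:R != 0 :> R by rewrite pnatr_eq0 -lt0n.
have -> : n%:R * Qform k u
   = - (1 / k%:R ^+ 2) * (n%:R * \sum_(i < n) u 0 i * window R n k u 0 i)
     + 1 / k%:R ^+ 3
       * (n%:R * \sum_(i < n) window R n k u 0 i * window R n k u 0 i).
  rewrite /Qform.
  under [X in _ = _ * (_ * X) + _]eq_bigr do rewrite mxE.
  under [X in _ = _ + _ * (_ * X)]eq_bigr do rewrite mxE -expr2.
  ring.
rewrite -!parseval !mulr_sumr -big_split; apply: eq_bigr => p _ /=.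
rewrite gamma_coefE !dft_cos_window !dft_sin_window /dft_energy.
by field.
Qed.

(** Opposite frequencies have conjugate [lambda], and [gamma_coef] sees only the real part and the
    modulus. *)
Lemma gamma_coef_sym (R : realType) (n p m k : nat) : (0 < n)%N ->
  (p + m = n)%N -> gamma_coef R n p k = gamma_coef R n m k.
Proof.
move=> n0 pm.
have E j : angle R n (p * j) = - angle R n (m * j) + angle R n (n * j).
  by rewrite -pm mulnDl [angle _ _ (_ + _)]angleD; ring.
rewrite !gamma_coefE.
have -> : lambda_re R n p k = lambda_re R n m k.
  by apply: eq_bigr => j _; rewrite E cosD_angle // cosN.
have -> : lambda_im R n p k = - lambda_im R n m k.
  by rewrite -sumrN; apply: eq_bigr => j _; rewrite E sinD_angle // sinN.
by rewrite sqrrN.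
Qed.

(** * Vectors of a single mode *)

Lemma mode_entries (R : realType) (n m : nat) (i : 'I_n) :
  cos_mode R n m 0 i = cos (angle R n (m * i)) /\
  sin_mode R n m 0 i = sin (angle R n (m * i)).
Proof.
by rewrite !mxE /angle natrM mulrA.
Qed.

Lemma mode_span (R : realType) (n m : nat) (u : 'rV[R]_n) :
  u \in <<[:: cos_mode R n m; sin_mode R n m]>>%VS ->
  exists a b : R, forall i, u 0 i
    = a * cos (angle R n (m * i)) + b * sin (angle R n (m * i)).
Proof.
rewrite span_cons span_seq1 => /memv_addP[_ /vlineP[a ->] [_ /vlineP[b ->] ->]].
exists a, b => i; have [<- <-] := mode_entries R n m i.
by rewrite mxE [X in X + _]mxE [X in _ + X]mxE.
Qed.

(** Orthogonality of modes: the product-to-sum formulas leave only full-period sums at frequencies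
    [p + m] and [p - m], neither divisible by [n]. *)
Lemma dft_energy_mode (R : realType) (n m p : nat) (u : 'rV[R]_n) :
  (0 < m < n)%N -> (p < n)%N -> p != m -> (p + m)%N != n ->
  u \in <<[:: cos_mode R n m; sin_mode R n m]>>%VS ->
  dft_energy R n u p = 0.
Proof.
move=> /andP[m0 mn] pn pm pmn /mode_span[a [b uE]].
have n0 : (0 < n)%N by lia.
have dP : (n %| p + m)%N = false.
  apply/negP => /dvdnP[q qE]; have : (q = 1)%N by nia.
  by move=> q1; move: pmn; rewrite qE q1 mul1n eqxx.
have dM : (n %| p + (n - m))%N = false.
  apply/negP => /dvdnP[q qE]; have : (q = 1)%N by nia.
  by move=> q1; move: qE pm; rewrite q1; lia.
have [CP SP] := sum_angle R n (p + m) n0.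
have [CM SM] := sum_angle R n (p + (n - m)) n0.
rewrite dP mulr0 in CP; rewrite dM mulr0 in CM.
have angP (i : nat) : angle R n ((p + m) * i)
    = angle R n (p * i) + angle R n (m * i) by rewrite mulnDl angleD.
have angM (i : nat) : angle R n ((p + (n - m)) * i)
    = angle R n (p * i) - angle R n (m * i) + angle R n (n * i).
  by rewrite mulnC angle_sub 1?ltnW // ![(i * _)%N]mulnC.
have -> : dft_energy R n u p
  = ((a / 2) * (\sum_(i < n) cos (angle R n ((p + (n - m)) * i))
               + \sum_(i < n) cos (angle R n ((p + m) * i)))
    + (b / 2) * (\sum_(i < n) sin (angle R n ((p + m) * i))
               - \sum_(i < n) sin (angle R n ((p + (n - m)) * i)))) ^+ 2
  + ((a / 2) * (\sum_(i < n) sin (angle R n ((p + m) * i))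
               + \sum_(i < n) sin (angle R n ((p + (n - m)) * i)))
    + (b / 2) * (\sum_(i < n) cos (angle R n ((p + (n - m)) * i))
               - \sum_(i < n) cos (angle R n ((p + m) * i)))) ^+ 2.
  rewrite -!big_split -!sumrB !mulr_sumr -!big_split.
  congr (_ ^+ 2 + _ ^+ 2); apply: eq_bigr => i _ /=;
    rewrite uE angP angM ?cosD_angle ?sinD_angle // cosB cosD sinB sinD; by field.
by rewrite CP CM SP SM !(addr0, subr0, mulr0) expr0n addr0.
Qed.

Lemma Qform_mode (R : realType) (n m k : nat) : (0 < k)%N -> (0 < m < n)%N ->
  has_coefficient_on_mode n k (gamma_coef R n m k) m.
Proof.
move=> k0 hm u hu; have n0 : (0 < n)%N by lia.
have nR : n%:R != 0 :> R by rewrite pnatr_eq0 -lt0n.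
apply: (mulfI nR); rewrite Qform_spectral // mulrCA -sum_dft_energy mulr_sumr.
apply: eq_bigr => p _.
have [->//|pm] := eqVneq (p : nat) m.
have [pmn|pmn] := eqVneq (p + m)%N n.
  (* The mirror frequency [n - m] may carry energy too, but with the same coefficient. *)
  by rewrite (gamma_coef_sym R n p m).
by rewrite (dft_energy_mode R n m p u) // !mulr0.
Qed.

(** * The sharp constant *)

Lemma dft_energy0 (R : realType) (n : nat) (u : 'rV[R]_n) :
  \sum_(i < n) u 0 i = 0 -> dft_energy R n u 0 = 0.
Proof.
move=> u0; rewrite /dft_energy /dft_cos /dft_sin.
have E (i : nat) : angle R n (0 * i) = 0 by rewrite /angle mulr0 mul0r.
under eq_bigr do rewrite E cos0 mulr1.
under [X in _ + X ^+ 2]eq_bigr do rewrite E sin0 mulr0.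
by rewrite u0 sumr_const mul0rn expr0n addr0.
Qed.

Lemma Cloc_le (R : realType) (n k m : nat) : (0 < m < n)%N ->
  Cloc R n k <= gamma_coef R n m k.
Proof. by move=> hm; apply: ge_bigmin_seq => //; rewrite mem_index_iota. Qed.

(** Termwise comparison of the two spectral sums: frequency 0 carries no energy, and every other
    [gamma_coef] is at least the minimum. *)
Lemma Cloc_lower_bound (R : realType) (n k : nat) (u : 'rV[R]_n) :
  (0 < n)%N -> (0 < k)%N -> \sum_(i < n) u 0 i = 0 ->
  Cloc R n k * (\sum_(i < n) u 0 i ^+ 2) <= Qform k u.
Proof.
move=> n0 k0 u0; have nR : 0 < n%:R :> R by rewrite ltr0n.
rewrite -(ler_pM2l nR) mulrCA -sum_dft_energy Qform_spectral // mulr_sumr.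
apply: ler_sum => p _; have [p0|p0] := eqVneq (p : nat) 0%N.
  by rewrite p0 dft_energy0 // !mulr0.
apply: ler_wpM2r; first by rewrite addr_ge0 // sqr_ge0.
by apply: Cloc_le; rewrite lt0n p0 /=.
Qed.

Lemma Cloc_sharp (R : realType) (n k : nat) (C : R) : (1 < n)%N -> (0 < k)%N ->
  (forall u : 'rV[R]_n, \sum_(i < n) u 0 i = 0 ->
     C * (\sum_(i < n) u 0 i ^+ 2) <= Qform k u) ->
  C <= Cloc R n k.
Proof.
move=> n1 k0 hC; have n0 : (0 < n)%N by lia.
have le_gamma m : (0 < m < n)%N -> C <= gamma_coef R n m k.
  move=> hm; pose u := cos_mode R n m.
  have entry i : u 0 i = cos (angle R n (m * i)) := (mode_entries R n m i).1.
  have u0 : \sum_(i < n) u 0 i = 0.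
    under eq_bigr do rewrite entry.
    rewrite (sum_angle R n m n0).1 gtnNdvd ?mulr0 //; lia.
  have := hC u u0; rewrite (Qform_mode R n m k k0 hm u) ?ler_pM2r //.
    (* Dividing by the squared norm is legitimate: the entry at index 0 is [cos 0 = 1]. *)
    rewrite (bigD1 (Ordinal n0)) //= ltr_wpDr //.
      by rewrite sumr_ge0 // => i _; rewrite sqr_ge0.
    by rewrite entry /= muln0 /angle mulr0 mul0r cos0 expr1n.
  by rewrite memv_span // mem_head.
(* The default value of the minimum must be bounded as well; it is the case [m = 1], admissible
   since [1 < n]. *)
rewrite /Cloc big_nat; apply: le_bigmin => [|m hm]; apply: le_gamma => //.
Qed.

Theorem lemma4p1 (R : realType) (n k : nat)
    (hn : (2 <= n)%N) (hk1 : (1 <= k)%N) (hkn : (k <= n - 1)%N) :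
  (forall m : nat, (1 <= m <= n - 1)%N ->
     has_coefficient_on_mode n k (gamma_coef R n m k) m)
  /\ (forall u : 'rV[R]_n, \sum_(i < n) u 0 i = 0 ->
        Cloc R n k * (\sum_(i < n) u 0 i ^+ 2) <= Qform k u)
  /\ (forall C : R,
        (forall u : 'rV[R]_n, \sum_(i < n) u 0 i = 0 ->
           C * (\sum_(i < n) u 0 i ^+ 2) <= Qform k u) ->
        C <= Cloc R n k).
Proof.
split=> [m hm|]; first by apply: Qform_mode => //; lia.
split=> [u u0|C hC]; first by apply: Cloc_lower_bound => //; lia.
exact: Cloc_sharp.
Qed.
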